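(* Let $k\geq 3$ and let $(x_n)_{n\geq 0}$ be a sequence of integers satisfying $x_n=b_1x_{n-1}+b_2x_{n-2}+\dots+b_kx_{n-k}$ for all integers $n\geq k$, where $b_1,\dots,b_k\in\mathbb{Z}$, $b_k\neq 0$, with initial values $x_0=x_1=\dots=x_{k-2}=0$, $x_{k-1}=1$. Suppose that the characteristic polynomial $x^k-b_1x^{k-1}-\dots-b_k$ equals $(x-a_1)^2(x-a_2)(x-a_3)\cdots(x-a_{k-1})$, where $a_i\in\mathbb{Z}$ and $a_i\neq a_j$ for $1\leq i\neq j\leq k-1$. Let $p$ be a prime with $p\nmid a_1a_2\cdots a_{k-1}$. If $a_i\not\equiv a_j\pmod p$ for all $i\neq j$, then the quotient set of $(x_n)_{n\geq 0}$ is dense in $\mathbb{Q}_p$.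
   Context: The quotient set (ratio set) of a sequence $(x_n)_{n\ge0}$ of integers is $\{x_m/x_n : m,n\geq 0,\ x_n\neq 0\}$. $\mathbb{Q}_p$ denotes the field of $p$-adic numbers with the $p$-adic topology. *)

(* Defs.v *)
From HB Require Import structures.
From mathcomp Require Export all_boot all_order all_algebra fraction.
From mathcomp Require Export boolp classical_sets topology.

Set Implicit Arguments.
Unset Strict Implicit.
Unset Printing Implicit Defensive.

Import GRing.Theory Num.Theory.
Local Open Scope classical_set_scope.
Local Open Scope ring_scope.

(* The ring Z_p as the inverse limit of the rings Z/p^n: the class of z in
   Z/p^n is represented by its residue in {0, ..., p^n - 1}, a constraint that
   [zpcoh] already imposes. *)
Record padic_int (p : nat) (p_pr : prime p) := PadicInt {
  zpres :> nat -> int;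
  zpcoh : forall n, zpres n = (zpres n.+1 %% p%:Z ^+ n)%Z
}.

Section PadicIntegers.
Variables (p : nat) (p_pr : prime p).
Local Notation Zp := (padic_int p_pr).
Local Notation q n := (p%:Z ^+ n).

HB.instance Definition _ := gen_eqMixin Zp.
HB.instance Definition _ := gen_choiceMixin Zp.

Lemma zpP (x y : Zp) : (forall n, x n = y n) -> x = y.
Proof.
case: x y => [x hx] [y hy] /= /funext exy; subst y.
by congr PadicInt; apply: Prop_irrelevance.
Qed.

Lemma zp_modS (m : int) n : ((m %% q n.+1)%Z = m %[mod q n])%Z.
Proof.
by rewrite [in RHS](divz_eq m (q n.+1)) exprS mulrA modzMDl.
Qed.

Lemma zp_mod (x : Zp) n : (x n %% q n)%Z = x n.
Proof. by rewrite zpcoh modz_mod. Qed.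

Lemma zp_mk_subproof (s : nat -> int) :
  (forall n, (s n.+1 = s n %[mod q n])%Z) ->
  forall n, ((s n %% q n) = ((s n.+1 %% q n.+1)%Z %% q n))%Z.
Proof. by move=> hs n; rewrite zp_modS hs. Qed.

Definition zp_mk s hs : Zp := PadicInt p_pr (@zp_mk_subproof s hs).

Lemma zp_add_subproof (x y : Zp) n :
  (x n.+1 + y n.+1 = x n + y n %[mod q n])%Z.
Proof. by rewrite (zpcoh x n) (zpcoh y n) modzDm. Qed.
Lemma zp_mul_subproof (x y : Zp) n :
  (x n.+1 * y n.+1 = x n * y n %[mod q n])%Z.
Proof. by rewrite (zpcoh x n) (zpcoh y n) modzMm. Qed.
Lemma zp_opp_subproof (x : Zp) n : (- x n.+1 = - x n %[mod q n])%Z.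
Proof. by rewrite (zpcoh x n) modzNm. Qed.

Definition zp_const (m : int) : Zp :=
  @zp_mk (fun=> m) (fun n => erefl).
Definition zp_add (x y : Zp) : Zp :=
  @zp_mk (fun n => x n + y n) (zp_add_subproof x y).
Definition zp_mul (x y : Zp) : Zp :=
  @zp_mk (fun n => x n * y n) (zp_mul_subproof x y).
Definition zp_opp (x : Zp) : Zp :=
  @zp_mk (fun n => - x n) (zp_opp_subproof x).

Lemma zp_addA : associative zp_add.
Proof. by move=> x y z; apply: zpP => n /=; rewrite modzDml modzDmr addrA. Qed.
Lemma zp_addC : commutative zp_add.
Proof. by move=> x y; apply: zpP => n /=; rewrite addrC. Qed.
Lemma zp_add0 : left_id (zp_const 0) zp_add.
Proof. by move=> x; apply: zpP => n /=; rewrite mod0z add0r zp_mod. Qed.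
Lemma zp_addN : left_inverse (zp_const 0) zp_opp zp_add.
Proof. by move=> x; apply: zpP => n /=; rewrite modzDml addNr. Qed.

HB.instance Definition _ :=
  GRing.isZmodule.Build Zp zp_addA zp_addC zp_add0 zp_addN.

Lemma zp_mulA : associative zp_mul.
Proof. by move=> x y z; apply: zpP => n /=; rewrite modzMml modzMmr mulrA. Qed.
Lemma zp_mulC : commutative zp_mul.
Proof. by move=> x y; apply: zpP => n /=; rewrite mulrC. Qed.
Lemma zp_mul1 : left_id (zp_const 1) zp_mul.
Proof. by move=> x; apply: zpP => n /=; rewrite modzMml mul1r zp_mod. Qed.
Lemma zp_mulDl : left_distributive zp_mul zp_add.
Proof.
by move=> x y z; apply: zpP => n /=; rewrite modzMml modzDml modzDmr mulrDl.
Qed.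

Lemma zp_const_eq0 (m : int) : zp_const m = 0 -> m = 0.
Proof.
move=> /(congr1 (fun x : Zp => x `|m|%N)) /= /eqP; rewrite mod0z => /eqP.
move/dvdz_mod0P => /dvdzP[r mE]; apply/eqP; apply: contraT => m0.
have : (p ^ `|m| <= `|m|)%N.
  apply: dvdn_leq; first by rewrite absz_gt0.
  by apply/dvdnP; exists `|r|%N; rewrite {1}mE abszM abszX.
by rewrite leqNgt ltn_expl // prime_gt1.
Qed.

Lemma zp_1neq0 : zp_const 1 != 0.
Proof. by apply/eqP => /zp_const_eq0. Qed.

HB.instance Definition _ := GRing.Zmodule_isComNzRing.Build Zp
  zp_mulA zp_mulC zp_mul1 zp_mulDl zp_1neq0.

Definition zp_unit : {pred Zp} := fun x => `[< exists y : Zp, y * x = 1 >].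
Definition zp_inv (x : Zp) : Zp :=
  if pselect (exists y : Zp, y * x = 1) is left h then projT1 (cid h) else x.

Lemma zp_mulV : {in zp_unit, left_inverse 1 zp_inv *%R}.
Proof.
move=> x /asboolP hx; rewrite /zp_inv; case: pselect => // h.
exact: projT2 (cid h).
Qed.
Lemma zp_unitPl (x y : Zp) : y * x = 1 -> zp_unit x.
Proof. by move=> yx; apply/asboolP; exists y. Qed.
Lemma zp_inv_out : {in [predC zp_unit], zp_inv =1 id}.
Proof.
by move=> x /asboolPn nx; rewrite /zp_inv; case: pselect.
Qed.

HB.instance Definition _ := GRing.ComNzRing_hasMulInverse.Build Zp
  zp_mulV zp_unitPl zp_inv_out.

Lemma zp_modD (x : Zp) n m : (x (n + m)%N = x n %[mod q n])%Z.
Proof.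
elim: m => [|m IHm]; first by rewrite addn0.
rewrite addnS -IHm (zpcoh x (n + m)) exprD; set k := q m.
apply/eqP; rewrite eqz_mod_dvd.
rewrite [X in (_ %| X - _)%Z](divz_eq _ (q n * k)) addrK.
by rewrite mulrCA dvdz_mulr.
Qed.

Lemma zp_neq0 (x : Zp) : x != 0 -> exists n, ~~ (q n %| x n)%Z.
Proof.
move=> x0; apply: contrapT => /forallNP h; case/eqP: x0; apply: zpP => n.
rewrite -zp_mod; move: (h n) => /negP; rewrite negbK => /dvdz_mod0P ->.
by rewrite /= mod0z.
Qed.

Lemma zp_integral : GRing.integral_domain_axiom Zp.
Proof.
move=> x y xy0; apply: contraT.
rewrite negb_or => /andP[/zp_neq0[n xn] /zp_neq0[m ym]].
have /= xynm := congr1 (fun z : Zp => z (n + m)%N) xy0.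
move: xynm; rewrite mod0z => /dvdz_mod0P.
have {}xn : ~~ (q n %| x (n + m)%N)%Z.
  by rewrite (sameP dvdz_mod0P eqP) zp_modD -(sameP dvdz_mod0P eqP).
have {}ym : ~~ (q m %| y (n + m)%N)%Z.
  by rewrite addnC (sameP dvdz_mod0P eqP) zp_modD -(sameP dvdz_mod0P eqP).
move: xn ym; rewrite !dvdzE !abszX abszM /=.
set a := `|x _|%N; set b := `|y _|%N => xn ym.
have a0 : (0 < a)%N by case: (a) xn => //; rewrite dvdn0.
have b0 : (0 < b)%N by case: (b) ym => //; rewrite dvdn0.
move: xn ym; rewrite !pfactor_dvdn ?muln_gt0 ?a0 // lognM // -!ltnNge => xn ym.
move=> h; have := leq_add xn ym; rewrite addSn addnS => /ltnW /leq_trans /(_ h).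
by rewrite ltnn.
Qed.

HB.instance Definition _ := GRing.ComUnitRing_isIntegral.Build Zp zp_integral.

Lemma zp_intr (m : int) : m%:~R = zp_const m.
Proof.
have natE (n : nat) : n%:R = zp_const n%:Z.
  elim: n => [//|n IHn]; rewrite -natr1 IHn; apply: zpP => j /=.
  by rewrite modzDm -PoszD addn1.
case: m => n; first exact: natE.
rewrite NegzE mulrNz -pmulrn natE; apply: zpP => j /=.
by rewrite modzNm.
Qed.

End PadicIntegers.

Definition padic (p : nat) (p_pr : prime p) := {fraction (padic_int p_pr)}.

Section PadicNumbers.
Variables (p : nat) (p_pr : prime p).
Local Notation Zp := (padic_int p_pr).
Local Notation Qp := (padic p_pr).

HB.instance Definition _ := GRing.Field.on Qp.

(* Q_p has characteristic 0, so [ratr : rat -> Qp] is the field embedding. *)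
Lemma padic_intr_eq0 (m : int) : (m%:~R == 0 :> Qp) = (m == 0).
Proof.
apply/eqP/eqP => [|-> //]; rewrite -(rmorph_int (@FracField.tofrac Zp)).
by move/eqP; rewrite tofrac_eq0 zp_intr => /eqP /zp_const_eq0.
Qed.

(* The closed ball x + p^n Z_p of radius p^-n. *)
Definition padic_ball (x : Qp) (n : nat) : set Qp :=
  [set y | exists z : Zp, y = x + p%:R ^+ n * FracField.tofrac z].

Definition padic_open (U : set Qp) :=
  forall x, U x -> exists n, padic_ball x n `<=` U.

Lemma padic_ball_le (x : Qp) n m :
  (n <= m)%N -> padic_ball x m `<=` padic_ball x n.
Proof.
move=> nm _ [z ->]; exists (p%:R ^+ (m - n) * z).
by rewrite tofracM tofracXn rmorph_nat mulrA -exprD subnKC.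
Qed.

Lemma padic_openT : padic_open setT.
Proof. by move=> x _; exists 0%N. Qed.

Lemma padic_openI : setI_closed padic_open.
Proof.
move=> U V oU oV x [/oU[n nU] /oV[m mV]]; exists (maxn n m) => y hy.
split; [apply: nU|apply: mV]; apply: padic_ball_le hy.
  exact: leq_maxl.
exact: leq_maxr.
Qed.

Lemma padic_open_bigU (I : Type) (f : I -> set Qp) :
  (forall i, padic_open (f i)) -> padic_open (\bigcup_i f i).
Proof.
move=> of_ x [i _ /of_[n nf]]; exists n => y /nf fy.
by exists i.
Qed.

HB.instance Definition _ := isOpenTopological.Build Qp
  padic_openT padic_openI padic_open_bigU.

End PadicNumbers.

Definition quotient_set (x : nat -> int) : set rat :=
  [set r | exists m n, x n != 0 /\ r = (x m)%:~R / (x n)%:~R].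

(* Main.v *)
Require Import Defs.
From mathcomp Require Import ring zify.
From mathcomp Require finfield.

Set Implicit Arguments.
Unset Strict Implicit.
Unset Printing Implicit Defensive.

Import GRing.Theory Num.Theory.
Import Pdiv.Ring Pdiv.RingMonic.
Local Open Scope classical_set_scope.
Local Open Scope ring_scope.

(** Let P be the characteristic polynomial and F = prod_i (X - a_i), so that P
    divides F^2. Then x_n = phi(X^n), where phi(h) is the coefficient of X^(k-1)
    in the remainder of h modulo P. As the a_i are distinct units modulo p,
    X^(p-1) = 1 + T with T = F G + p H. Modulo P, T^2 is divisible by p and T^3
    by p^2, hence X^((p-1) p^N) = 1 + p^N (T + p S), and taking M-th powers,
      x_((p-1) p^N M) = p^N (M w + p^N z)  with  w = phi(T) modulo p.
    Now phi(T) = phi(F G) = G(a_1) modulo p, and differentiating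
    X^(p-1) = 1 + F G + p H at a_1 shows that p does not divide G(a_1).
    The quotient of the terms for M and for p^e therefore tends to M / p^e as N
    grows, and the rationals M / p^e are dense in Q_p. *)

(** * Truncated binomial expansion and divisibility by a prime *)

Lemma expr1D_trunc3 (R : comNzRingType) (y : R) m :
  exists v, (1 + y) ^+ m = 1 + m%:R * y + 'C(m, 2)%:R * y ^+ 2 + y ^+ 3 * v.
Proof.
elim: m => [|m [v IHm]]; first by exists 0; rewrite expr0 !mul0r mulr0 !addr0.
exists ('C(m, 2)%:R + v + v * y).
rewrite exprSr IHm binS bin1 natrD -natr1; ring.
Qed.

Lemma euclid_dvdzM p (m n : int) : prime p ->
  (p%:Z %| m * n)%Z = (p%:Z %| m)%Z || (p%:Z %| n)%Z.
Proof. by move=> p_pr; rewrite !dvdzE abszM Euclid_dvdM. Qed.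

Lemma euclid_dvdzX p (m : int) n : prime p ->
  (p%:Z %| m ^+ n)%Z -> (p%:Z %| m)%Z.
Proof. by move=> p_pr; rewrite !dvdzE abszX Euclid_dvdX // => /andP[]. Qed.

Lemma coprimez_primeX p (m : int) n : prime p -> ~~ (p%:Z %| m)%Z ->
  coprimez m (p%:Z ^+ n).
Proof.
move=> p_pr pm; rewrite coprimezXr // coprimez_sym.
by rewrite /coprimez /gcdz -(prime_coprime _ p_pr) in pm *.
Qed.

(** * Factoring [X^(p-1) - 1] modulo p *)

Section Roots.
Variables (p : nat) (p_pr : prime p).

Lemma intFp_eq0 (m : int) : (m%:~R == 0 :> 'F_p) = (p%:Z %| m)%Z.
Proof. by rewrite (dvdz_pcharf (pchar_Fp p_pr)). Qed.

Lemma expFp_pred (c : 'F_p) : c != 0 -> c ^+ p.-1 = 1.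
Proof.
move=> c0; apply: (mulfI c0); rewrite mulr1 -exprS prednK ?prime_gt0 //.
by have := finfield.expf_card c; rewrite card_Fp.
Qed.

Lemma poly_int_eq0_Fp (r : {poly int}) :
  map_poly (intr : int -> 'F_p) r = 0 -> exists H, r = p%:R * H.
Proof.
move=> r0; exists (\poly_(i < size r) (r`_i %/ p%:Z)%Z).
have -> : p%:R = (p%:Z)%:P :> {poly int} by rewrite -natz rmorph_nat.
apply/polyP => i; rewrite coefCM coef_poly.
case: ltnP => [_|/leq_sizeP->]; rewrite ?mulr0 //.
rewrite mulrC divzK // -intFp_eq0.
by have /polyP/(_ i) := r0; rewrite coef_map coef0 => ->.
Qed.

(** By Fermat, the remainder of [X^(p-1) - 1] modulo the product vanishes in F_p at every element of
    [s]. These are distinct and outnumber its degree, so all its coefficients are divisible by p. *)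
Lemma Xpred_sub1_factor (s : seq int) :
  all (fun c => ~~ (p%:Z %| c)%Z) s ->
  uniq [seq c%:~R : 'F_p | c <- s] ->
  exists G H : {poly int},
    'X^(p.-1) = 1 + (\prod_(c <- s) ('X - c%:P) * G + p%:R * H).
Proof.
move=> s0 us; set F := \prod_(_ <- _) _.
have mF : F \is monic by apply: monic_prod_XsubC.
have E := rdivp_eq mF ('X^(p.-1) - 1).
exists (rdivp ('X^(p.-1) - 1) F).
have sr := ltn_rmodp ('X^(p.-1) - 1) F; rewrite monic_neq0 // in sr.
set r := rmodp _ _ in E sr *.
have [|H rE] := @poly_int_eq0_Fp r.
  apply: contraTeq isT => r0.
  suff /(max_poly_roots r0)/(_ us) :
      all (root (map_poly intr r)) [seq (c%:~R : 'F_p) | c <- s].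
    rewrite size_map ltnNge; apply: contraNN => _.
    by apply: leq_trans (size_poly _ _) _; rewrite -ltnS -(size_prod_XsubC s id).
  apply/allP => _ /mapP[c cs ->]; apply/rootP.
  rewrite horner_map /=.
  have -> : r.[c] = c ^+ p.-1 - 1.
    have Fc : F.[c] = 0 by apply/rootP; rewrite root_prod_XsubC.
    move/(congr1 (horner^~ c)): E; rewrite !(hornerD, hornerM) Fc mulr0 add0r.
    by move=> <-; rewrite !hornerE.
  rewrite intrB rmorphXn expFp_pred ?subrr //.
  by rewrite intFp_eq0; apply: (allP s0).
exists H; rewrite -rE [_ * rdivp _ _]mulrC -E; ring.
Qed.

End Roots.

(** * Powers of X modulo the characteristic polynomial *)

Lemma exprDM (R : comNzRingType) (y u v : R) m :
  exists w, (y + u * v) ^+ m = y ^+ m + u * w.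
Proof.
elim: m => [|m [w IHm]]; first by exists 0; rewrite mulr0 addr0.
exists (w * y + w * u * v + y ^+ m * v); rewrite !exprSr IHm; ring.
Qed.

(** As p is odd, p divides ['C(p, 2)], so the quadratic term gains a factor p. The hypotheses on
    [T ^+ 2] and [T ^+ 3] serve the first p-th power; afterwards the factor [p%:R ^+ N.+1] makes the
    higher terms small enough. *)
Lemma expr1D_primeX (R : comNzRingType) (p : nat) (P T A B C D : R) :
  prime p -> (2 < p)%N ->
  T ^+ 2 = P * A + p%:R * B -> T ^+ 3 = P * C + p%:R ^+ 2 * D ->
  forall N, exists S E,
    (1 + T) ^+ (p ^ N.+1)%N = 1 + p%:R ^+ N.+1 * (T + p%:R * S) + P * E.
Proof.
move=> p_pr p2 T2 T3.
have [q Eq] : exists q, 'C(p, 2)%:R = p%:R * q :> R.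
  have /dvdnP[q ->] := prime_dvd_bin p_pr (p2 : (0 < 2 < p)%N); exists q%:R.
  by rewrite natrM mulrC.
elim=> [|N [S [E IHN]]].
  have [v ->] := expr1D_trunc3 T p.
  exists (q * B + D * v), (p%:R * q * A + C * v).
  rewrite Eq T2 T3; ring.
pose c : R := p%:R ^+ N; pose W := T + p%:R * S.
have [v Ev] := expr1D_trunc3 (p%:R ^+ N.+1 * W) p.
have [g Eg] := exprDM (1 + p%:R ^+ N.+1 * W) P E p.
exists (S + q * c * W ^+ 2 + c ^+ 2 * W ^+ 3 * v).
exists g.
rewrite expnSr exprM IHN Eg Ev Eq !exprS -/c /W; ring.
Qed.

(** Modulo P the powers of X obey the recurrence of [x], and for n < k the coefficient of X^(k-1) in
    X^n reproduces the initial values 0, ..., 0, 1. *)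
Lemma linrec_rmodp (k : nat) (x b : nat -> int) (P : {poly int}) :
  (0 < k)%N ->
  (forall n, (k <= n)%N -> x n = \sum_(1 <= i < k.+1) b i * x (n - i)%N) ->
  (forall n, (n < k.-1)%N -> x n = 0) -> x k.-1 = 1 ->
  P \is monic -> size P = k.+1 ->
  'X^k - \sum_(1 <= i < k.+1) b i *: 'X^(k - i) = P ->
  forall n, x n = (rmodp 'X^n P)`_k.-1.
Proof.
move=> k0 xrec x0 x1 mP sP EP; elim/ltn_ind => n IHn.
have [nk|kn] := ltnP n k.
  rewrite rmodp_small ?size_polyXn ?sP // coefXn.
  case: ltngtP => [kn|/x0 //|<-//].
  by rewrite -ltnS prednK // in kn; rewrite ltnNge nk in kn.
have -> : 'X^n = 'X^(n - k) * P + \sum_(1 <= i < k.+1) b i *: 'X^(n - i).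
  rewrite -EP mulrBr -exprD subnK // mulr_sumr.
  rewrite [X in _ - X + _](_ : _ = \sum_(1 <= i < k.+1) b i *: 'X^(n - i)).
    by rewrite subrK.
  apply: eq_big_nat => i /andP[_ ik]; rewrite -scalerAr -exprD.
  by rewrite addnBA // subnK.
rewrite rmodpD // rmodp_mull // add0r rmodp_sum // coef_sum xrec //.
apply: eq_big_nat => i /andP[i0 _]; rewrite rmodpZ // coefZ IHn //.
by rewrite ltn_subrL i0 (leq_trans k0).
Qed.

(** Here [c] is the double root and [s] lists the simple ones. That [w] does not depend on [M] lets
    it cancel, up to a small error, when the terms for two values of [M] are divided. *)
Lemma linrec_primeX_expansion (k : nat) (x b : nat -> int) (c : int)
    (s : seq int) (p : nat) :
  prime p -> (2 < p)%N -> k = (size s).+2 ->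
  (forall n, (k <= n)%N -> x n = \sum_(1 <= i < k.+1) b i * x (n - i)%N) ->
  (forall n, (n < k.-1)%N -> x n = 0) -> x k.-1 = 1 ->
  'X^k - \sum_(1 <= i < k.+1) b i *: 'X^(k - i)
    = ('X - c%:P) ^+ 2 * \prod_(d <- s) ('X - d%:P) ->
  all (fun d => ~~ (p%:Z %| d)%Z) (c :: s) ->
  uniq [seq d%:~R : 'F_p | d <- c :: s] ->
  forall N, exists2 w : int, ~~ (p%:Z %| w)%Z & forall M, exists z : int,
    x (p.-1 * (p ^ N.+1 * M))%N
      = p%:Z ^+ N.+1 * (M%:R * w + p%:Z ^+ N.+1 * z).
Proof.
move=> p_pr p2 Ek xrec x0 x1 EP pcs ucs N.
set F2 := \prod_(_ <- _) _ in EP; set P := _ ^+ 2 * _ in EP.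
have [G [H EX]] := Xpred_sub1_factor p_pr pcs ucs.
rewrite big_cons -/F2 in EX; set F := _ * F2 in EX; set T := (X in 1 + X) in EX.
have mF2 : F2 \is monic by apply: monic_prod_XsubC.
have mX : 'X - c%:P \is monic by apply: monicXsubC.
have mP : P \is monic by rewrite rpredM ?rpredX.
have sF : size F = k.
  by rewrite size_Mmonic ?polyXsubC_eq0 ?size_XsubC ?size_prod_XsubC.
have PF : P = ('X - c%:P) * F by rewrite /P /F; ring.
have mF : F \is monic by rewrite rpredM.
have sP : size P = k.+1.
  by rewrite PF size_Mmonic ?polyXsubC_eq0 ?size_XsubC ?sF.
have k0 : (0 < k)%N by rewrite Ek.
have xE := linrec_rmodp k0 xrec x0 x1 mP sP EP.
pose phi h := (rmodp h P)`_k.-1.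
have phiD : {morph phi : f g / f + g} by move=> f g; rewrite /phi rmodpD ?coefD.
have phiP h : phi (P * h) = 0 by rewrite /phi mulrC rmodp_mull ?coef0.
have phiZ m h : phi (m%:P * h) = m * phi h.
  by rewrite /phi mul_polyC rmodpZ ?coefZ.
have pC : p%:R = (p%:Z)%:P :> {poly int} by rewrite -natz rmorph_nat.
have pXC n : p%:R ^+ n = (p%:Z ^+ n)%:P :> {poly int} by rewrite pC rmorphXn.
have phi1 : phi 1 = 0.
  by rewrite /phi -(expr0 'X) -xE x0 // Ek.
(* Dividing G by X - c gives F G = P Q + G(c) F, and [phi F = 1] because F is monic of degree k - 1.
   So [phi T] is G(c) modulo p. *)
have phiT : ~~ (p%:Z %| phi T)%Z.
  have [Q GE] : exists Q, G = ('X - c%:P) * Q + (G.[c])%:P.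
    have /factor_theorem[Q EQ] : root (G - (G.[c])%:P) c.
      by rewrite /root !hornerE subrr.
    by exists Q; rewrite mulrC -EQ subrK.
  have phiF : phi F = 1.
    rewrite /phi rmodp_small ?sF ?sP //.
    by have /monicP := mF; rewrite lead_coefE sF.
  have -> : phi T = G.[c] + p%:Z * phi H.
    rewrite /T phiD pC phiZ {1}GE.
    have -> : F * (('X - c%:P) * Q + (G.[c])%:P) = P * Q + (G.[c])%:P * F.
      rewrite PF; ring.
    by rewrite phiD phiP phiZ phiF mulr1 add0r.
  rewrite rpredDr ?dvdz_mulr //; apply/negP => pG.
  (* At c the derivative of [EX] reads (p-1) c^(p-2) = F2(c) G(c) + p H'(c), as the factor X - c of
     F vanishes there. If p divided G(c), it would divide the left side. *)
  have := congr1 (fun h : {poly int} => h^`().[c]) EX.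
  rewrite /T /F pC !(derivE, hornerE) subrr !(mul0r, mulr0, add0r, addr0).
  rewrite hornerMn hornerXn /= addr0 => Ec.
  have : (p%:Z %| c ^+ p.-2 * p.-1%:Z)%Z.
    rewrite -natz mulr_natr Ec; apply: rpredD; first exact: dvdz_mull.
    exact: dvdz_mulr.
  rewrite euclid_dvdzM // => /orP[/(euclid_dvdzX p_pr)|].
    by apply/negP; have /andP[] := pcs.
  rewrite dvdzE /= gtnNdvd //; first by rewrite -ltnS prednK ?prime_gt0 ?prime_gt1.
  by rewrite prednK ?prime_gt0.
(* Both identities rest on F^2 = P F2: modulo P, only terms with at most one factor F survive. *)
have T2 : T ^+ 2 = P * (F2 * G ^+ 2) + p%:R * (2 * (F * G * H) + p%:R * H ^+ 2).
  rewrite /T /P /F; ring.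
have T3 : T ^+ 3 = P * (F2 * (F * G ^+ 3 + 3 * p%:R * G ^+ 2 * H))
                   + p%:R ^+ 2 * (3 * F * G * H ^+ 2 + p%:R * H ^+ 3).
  rewrite /T /P /F; ring.
have [S [E EN]] := expr1D_primeX p_pr p2 T2 T3 N.
set W := T + _ in EN.
exists (phi W).
  by rewrite /W phiD pC phiZ rpredDr ?dvdz_mulr.
move=> M; have [g Eg] := exprDM (1 + p%:R ^+ N.+1 * W) P E M.
have [v Ev] := expr1D_trunc3 (p%:R ^+ N.+1 * W) M.
(* The second-order part of (1 + h W)^M with h = p^(N+1), divided by h^2. The constant 1 contributes
   [phi 1], which is x_0 = 0. *)
exists (phi ('C(M, 2)%:R * W ^+ 2 + p%:R ^+ N.+1 * (W ^+ 3 * v))).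
rewrite xE exprM EX exprM EN Eg Ev -/(phi _).
have -> : forall h : {poly int},
  1 + M%:R * (h * W) + 'C(M, 2)%:R * (h * W) ^+ 2 + (h * W) ^+ 3 * v + P * g
  = 1 + M%:R * h * W + h ^+ 2 * ('C(M, 2)%:R * W ^+ 2 + h * (W ^+ 3 * v)) + P * g.
  by move=> h; ring.
have MC : M%:R = (M%:R)%:P :> {poly int} by rewrite rmorph_nat.
set Z := 'C(M, 2)%:R * _ + _.
rewrite 3!phiD phiP phi1 add0r addr0 pXC MC expr2 -!mulrA !phiZ; ring.
Qed.

(** * Approximation of p-adic numbers by fractions M / p^e *)

Lemma fraction_divE (R : idomainType) (y : {fraction R}) :
  exists m n : R, n != 0 /\ y = FracField.tofrac m / FracField.tofrac n.
Proof.
elim/quotW: y => r; exists \n_r, \d_r; split; first exact: denom_ratioP.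
apply: (canRL (mulfK _)); first by rewrite tofrac_eq0 denom_ratioP.
unlock FracField.tofrac; rewrite -[LHS]FracField.pi_mul; apply/eqmodP.
rewrite /= FracField.equivfE /FracField.mulf.
rewrite !numden_Ratio ?(mulf_neq0, oner_neq0, denom_ratioP) //.
by rewrite !mulr1 mulrC.
Qed.

Section PadicApproximation.
Variables (p : nat) (p_pr : prime p).
Local Notation Zp := (padic_int p_pr).
Local Notation Qp := (padic p_pr).
Local Notation tofrac := (@FracField.tofrac Zp).

(** Bezout inverts z modulo each p^n; inverses are unique modulo p^n, so the chosen ones are
    coherent. *)
Lemma zp_unit_residue (z : Zp) : ~~ (p%:Z %| z 1%N)%Z -> z \is a GRing.unit.
Proof.
move=> pz; have pzn n : ~~ (p%:Z %| z n.+1)%Z.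
  have := zp_modD z 1 n; rewrite add1n expr1 => h.
  by rewrite (sameP dvdz_mod0P eqP) h -(sameP dvdz_mod0P eqP).
have inv n : exists u : int, (u * z n = 1 %[mod p%:Z ^+ n])%Z.
  case: n => [|n]; first by exists 0; rewrite expr0 !modz1.
  have /coprimezP[[u v] /= uv] := coprimez_primeX n.+1 p_pr (pzn n).
  by exists u; rewrite -uv addrC modzMDl.
have [s sE] := choice inv.
have hs n : (s n.+1 = s n %[mod p%:Z ^+ n])%Z.
  have E1 : (s n.+1 * z n = 1 %[mod p%:Z ^+ n])%Z.
    rewrite (zpcoh z n) modzMmr.
    by rewrite -zp_modS sE zp_modS.
  rewrite -[s n.+1]mulr1 -modzMmr -sE modzMmr mulrCA.
  by rewrite -modzMmr E1 modzMmr mulr1.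
apply/unitrPr; exists (zp_mk p_pr hs).
by apply: zpP => n /=; rewrite modzMmr mulrC sE.
Qed.

(** The p-adic digits of z are shifted by n: [t] has residues (z_(n+m) - z_n) / p^n modulo p^m. *)
Lemma zp_approx (z : Zp) n : exists t : Zp, z = (z n)%:~R + p%:R ^+ n * t.
Proof.
pose s m := ((z (n + m)%N - z n) %/ p%:Z ^+ n)%Z.
have q0 : p%:Z ^+ n != 0 by rewrite expf_neq0 // -lt0n prime_gt0.
have sE m : s m * p%:Z ^+ n = z (n + m)%N - z n.
  by rewrite divzK // -eqz_mod_dvd; apply/eqP/zp_modD.
have hs m : (s m.+1 = s m %[mod p%:Z ^+ m])%Z.
  apply/eqP; rewrite eqz_mod_dvd -(dvdz_mul2r q0).
  rewrite mulrBl !sE opprB addrA subrK addnS -exprD addnC -eqz_mod_dvd.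
  by rewrite (zpcoh z (m + n)) modz_mod.
exists (zp_mk p_pr hs).
have -> : p%:R = (p%:Z)%:~R :> Zp by [].
rewrite -rmorphXn /= !zp_intr; apply: zpP => m /=.
rewrite modzDm -modzDmr modzMm modzDmr.
have : (z (n + m)%N = z n + p%:Z ^+ n * s m %[mod p%:Z ^+ m])%Z.
  by rewrite mulrC sE addrC subrK.
move=> <-.
by rewrite addnC zp_modD zp_mod.
Qed.

(** Factors p are stripped from z until a unit remains; this stops because z is nonzero modulo some
    p^n. *)
Lemma zp_dvd_primeX (z : Zp) : z != 0 -> exists e t, z * t = p%:R ^+ e.
Proof.
move=> /zp_neq0[n]; elim: n z => [|n IHn] z; first by rewrite expr0 dvd1z.
have [z1|/zp_unit_residue uz _] := boolP (p%:Z %| z 1%N)%Z; last first.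
  by exists 0%N, z^-1; rewrite divrr.
have [t zE] := zp_approx z 1; rewrite -zp_mod !expr1 in zE.
rewrite (dvdz_mod0P z1) add0r in zE => zn.
have [|e [u tu]] := IHn t; last by exists e.+1, u; rewrite zE -mulrA tu exprS.
apply: contraNN zn => tn.
have -> : z n.+1 = (p%:Z * t n.+1 %% p%:Z ^+ n.+1)%Z.
  by rewrite zE -[p%:R]/(p%:Z%:~R) zp_intr /= modzMml.
apply/dvdz_mod0P; rewrite modz_mod; apply/dvdz_mod0P; rewrite exprS dvdz_mul //.
by move/dvdz_mod0P: tn; rewrite (zpcoh t n) modz_mod => /dvdz_mod0P.
Qed.

Lemma padic_pX_neq0 n : p%:R ^+ n != 0 :> Qp.
Proof.
rewrite expf_neq0 // -[p%:R]/(p%:Z%:~R) padic_intr_eq0.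
by rewrite -lt0n prime_gt0.
Qed.

(** The denominator is first turned into a power p^e, then the numerator is truncated modulo
    p^(n+e). Its residue is nonnegative, so [M] is a natural number and can multiply an index of the
    sequence. *)
Lemma padic_approx (y : Qp) n : exists M e (t : Zp),
  y = M%:R / p%:R ^+ e + p%:R ^+ n * tofrac t.
Proof.
have [c [d [/zp_dvd_primeX[e [t dt]] ->]]] := fraction_divE y.
have t0 : d * t != 0 by rewrite dt -(tofrac_eq0) rmorphXn rmorph_nat padic_pX_neq0.
have [t' ctE] := zp_approx (c * t) (n + e).
pose m : int := zpres (c * t) (n + e); exists `|m|%N, e, t'.
have /andP[d0 {}t0] : (tofrac d != 0) && (tofrac t != 0).
  by rewrite !tofrac_eq0 -negb_or -mulf_eq0.
have -> : tofrac c / tofrac d = tofrac (c * t) / p%:R ^+ e.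
  rewrite -[p%:R](rmorph_nat tofrac) -rmorphXn -dt !rmorphM /=.
  by rewrite invfM mulrACA divff // mulr1.
rewrite ctE -/m.
have m0 : 0 <= m.
  by rewrite /m -zp_mod modz_ge0 // expf_neq0 // -lt0n prime_gt0.
rewrite rmorphD rmorphM rmorphXn rmorph_nat rmorph_int mulrDl; congr (_ + _).
  by rewrite -{1}(gez0_abs m0).
by rewrite exprD mulrAC mulfK ?padic_pX_neq0 // mulrAC.
Qed.

(** [ratr] uses the reduced numerator and denominator, hence the cross-multiplication. *)
Lemma padic_ratr (m n : int) : n != 0 ->
  ratr (m%:~R / n%:~R) = m%:~R / n%:~R :> Qp.
Proof.
move=> n0; set r : rat := _ / _.
have d0 : denq r != 0 by [].
rewrite /ratr; apply/eqP; rewrite eqr_div ?padic_intr_eq0 // -!intrM.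
apply/eqP; congr (_%:~R); apply: (@intr_inj rat).
rewrite !intrM; apply/eqP; rewrite -eqr_div ?intr_eq0 //.
by rewrite divq_num_den.
Qed.

End PadicApproximation.

(** For [P] = p, [Pn] = p^n, [Pe] = p^e, the left side is the quotient of the terms for M and p^e at
    level N = n + 2e, and the right side exhibits it in the ball of radius p^-n around M / p^e + p^n
    t. *)
Lemma approx_identity (K : fieldType) (P Pn Pe M w u z1 z2 t : K) :
  P != 0 -> Pn != 0 -> Pe != 0 -> u != 0 -> u = w + P * (Pn * Pe) * z2 ->
  P * (Pn * Pe ^+ 2) * (M * w + P * (Pn * Pe ^+ 2) * z1)
    / (P * (Pn * Pe ^+ 2) * (Pe * u))
  = M / Pe + Pn * t + Pn * ((P * Pe * z1 - M * P * z2) / u - t).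
Proof.
move=> P0 Pn0 Pe0 u0 uE; have -> : w = u - P * (Pn * Pe) * z2.
  by rewrite uE addrK.
by field; apply/and4P.
Qed.

(** * Density of the quotients *)

Lemma quotient_set_dense (p : nat) (p_pr : prime p) (x : nat -> int) :
  (forall N, exists2 w : int, ~~ (p%:Z %| w)%Z & forall M, exists i (z : int),
    x i = p%:Z ^+ N.+1 * (M%:R * w + p%:Z ^+ N.+1 * z)) ->
  dense ([set ratr r | r in quotient_set x] : set (padic p_pr)).
Proof.
move=> xexp O [y Oy] oO; have [n nO] : exists n, padic_ball y n `<=` O.
  exact: oO.
have [M [e [t yE]]] := padic_approx y n.
(* The error of the denominator is divided by p^e twice, so 2e extra powers of p keep it divisible
   by p^n. *)
have [w pw wE] := xexp (n + e * 2)%N.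
have [i [z1 xi]] := wE M; have [j [z2 xj]] := wE (p ^ e)%N.
(* [u] is [x j] with its power of p removed; being congruent to [w] modulo p, it is a unit of
   Z_p. *)
pose u := w + p%:Z ^+ (n + e).+1 * z2.
have pu : ~~ (p%:Z %| u)%Z.
  by rewrite rpredDr // exprS -mulrA dvdz_mulr.
have uu : u%:~R \is a @GRing.unit (padic_int p_pr).
  apply: zp_unit_residue; rewrite zp_intr /= expr1.
  by apply: contraNN pu => /dvdz_mod0P; rewrite modz_mod => /dvdz_mod0P.
have u0 : u != 0 by apply: contraNneq pu => ->; rewrite dvdz0.
have p0 : p%:Z != 0 by rewrite -lt0n prime_gt0.
have {}xj : x j = p%:Z ^+ (n + e * 2).+1 * (p%:Z ^+ e * u).
  rewrite xj; congr (_ * _); rewrite /u natrX natz mulrDr.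
  by rewrite [p%:Z ^+ e * (_ * _)]mulrA -exprD; congr (_ + p%:Z ^+ _ * _); lia.
have xj0 : x j != 0 by rewrite xj !mulf_neq0 ?expf_neq0.
exists (ratr ((x i)%:~R / (x j)%:~R)); split; last first.
  by exists ((x i)%:~R / (x j)%:~R) => //; exists i, j.
apply: nO; rewrite padic_ratr //.
exists ((p%:Z ^+ e.+1 * z1 - M%:R * p%:Z * z2)%:~R / u%:~R - t).
have U0 : u%:~R != 0 :> padic p_pr by rewrite padic_intr_eq0.
have P0 : p%:R != 0 :> padic p_pr by rewrite -[p%:R]/(p%:Z%:~R) padic_intr_eq0.
have intrXp m : (p%:Z ^+ m)%:~R = p%:R ^+ m :> padic p_pr by rewrite rmorphXn.
have intrn m : m%:R%:~R = m%:R :> padic p_pr by rewrite natz.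
have uE : u%:~R = w%:~R + p%:R ^+ (n + e).+1 * z2%:~R :> padic p_pr.
  by rewrite intrD intrM intrXp.
rewrite rmorphB rmorphM (rmorphV (@FracField.tofrac _) uu) !rmorph_int yE xi xj.
rewrite (intrM _ _ (_ + _)) (intrM _ _ (_ * u)) !intrXp intrD intrM intrn.
rewrite (intrM _ _ z1) (intrM _ _ u) intrB (intrM _ _ z1) (intrM _ _ z2) !intrXp.
rewrite (intrM _ _ p%:Z) intrn -[p%:Z%:~R]/(p%:R).
rewrite [p%:R ^+ (n + e * 2).+1]exprS exprD exprM.
rewrite [p%:R ^+ e.+1]exprS; rewrite exprS exprD in uE.
apply: approx_identity uE => //; exact: expf_neq0.
Qed.

Theorem theorem1p2 (k : nat) (x b a : nat -> int) (p : nat) (p_pr : prime p) :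
  (3 <= k)%N ->
  (forall n, (k <= n)%N -> x n = \sum_(1 <= i < k.+1) b i * x (n - i)%N) ->
  b k != 0 ->
  (forall n, (n <= k - 2)%N -> x n = 0) ->
  x (k - 1)%N = 1 ->
  'X^k - \sum_(1 <= i < k.+1) (b i) *: 'X^(k - i)
    = ('X - (a 1%N)%:P) ^+ 2 * \prod_(2 <= i < k) ('X - (a i)%:P) ->
  (forall i j, (1 <= i <= k - 1)%N -> (1 <= j <= k - 1)%N ->
    i != j -> a i != a j) ->
  ~~ (p%:Z %| \prod_(1 <= i < k) a i)%Z ->
  (forall i j, (1 <= i <= k - 1)%N -> (1 <= j <= k - 1)%N ->
    i != j -> (a i != a j %[mod p%:Z])%Z) ->
  dense ([set ratr r | r in quotient_set x] : set (padic p_pr)).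
Proof.
move=> k3 xrec _ x0 x1 EP _ pa amod.
pose s := [seq a i | i <- index_iota 2 k].
have sE : a 1%N :: s = [seq a i | i <- index_iota 1 k].
  by rewrite /s /index_iota -[(k - 1)%N]prednK ?subn_gt0 ?(ltnW k3) // -subnS.
have rng i : (i \in index_iota 1 k) = (1 <= i <= k - 1)%N.
  by rewrite mem_index_iota; lia.
have pai i : (1 <= i <= k - 1)%N -> ~~ (p%:Z %| a i)%Z.
  move=> hi; apply: contraNN pa => pai.
  by rewrite (big_rem i) ?rng //= dvdz_mulr.
(* If p were 2, then a_1 and a_2 (which exist since k >= 3) would both be odd, hence congruent
   modulo p. *)
have p2 : (2 < p)%N.
  rewrite ltn_neqAle prime_gt1 // andbT; apply/eqP => p2.
  have odda i : (1 <= i <= k - 1)%N -> (a i = 1 %[mod 2])%Z.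
    by move=> /pai; rewrite -p2; lia.
  have /eqP[] := amod 1%N 2%N ltac:(lia) ltac:(lia) isT.
  by rewrite -p2 !odda //; lia.
apply: quotient_set_dense => N.
have Ek : k = (size s).+2 by rewrite /s size_map size_iota; lia.
have x0' n : (n < k.-1)%N -> x n = 0 by move=> hn; apply: x0; lia.
have pcs : all (fun d => ~~ (p%:Z %| d)%Z) (a 1%N :: s).
  by rewrite sE; apply/allP => y /mapP[i]; rewrite rng => hi ->; apply: pai.
have ucs : uniq [seq d%:~R : 'F_p | d <- a 1%N :: s].
  rewrite sE -map_comp map_inj_in_uniq ?iota_uniq // => i j.
  rewrite !rng => hi hj /= eij; apply: contraTeq isT => nij.
  have := amod i j hi hj nij; rewrite eqz_mod_dvd -(intFp_eq0 p_pr).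
  by rewrite intrB eij subrr eqxx.
rewrite subn1 in x1; rewrite -(big_map a xpredT (fun d => 'X - d%:P)) in EP.
have [w pw wE] := linrec_primeX_expansion p_pr p2 Ek xrec x0' x1 EP pcs ucs N.
by exists w => // M; have [z zE] := wE M; exists (p.-1 * (p ^ N.+1 * M))%N, z.
Qed.
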